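(* Let $\mathcal H$ be a real Hilbert space, $A:\mathcal H\rightrightarrows\mathcal H$ a maximal monotone operator, and $\theta>0$. For any $x_0\in\Omega=\mathcal H\setminus A^{-1}(0)$ there exists a unique global solution $(x,\lambda):[0,+\infty[\to\mathcal H\times\mathbb R_{++}$ of the Cauchy problem $$\begin{cases}\dot x(t)+x(t)-(I+\lambda(t)A)^{-1}x(t)=0,\quad \lambda(t)>0,\\ \lambda(t)\,\|(I+\lambda(t)A)^{-1}x(t)-x(t)\|=\theta,\\ x(0)=x_0.\end{cases}$$ Equivalently, the Cauchy problem $\dot x(t)+x(t)-(I+\Lambda_\theta(x(t))A)^{-1}x(t)=0$, $x(0)=x_0$, has a unique solution $x:[0,+\infty[\to\mathcal H$. For this solution, $x(\cdot)$ is $\mathscr C^1$ and $\lambda(\cdot)$ is locally Lipschitz continuous. Moreover: i) $\lambda(\cdot)$ is non-decreasing; ii) $t\mapsto\|J_{\lambda(t)}x(t)-x(t)\|$ is non-increasing; iii) for any $0\le t_0\le t_1$, $$\lambda(t_0)\le\lambda(t_1)\le e^{(t_1-t_0)}\lambda(t_0),$$ $$\|J_{\lambda(t_0)}x(t_0)-x(t_0)\|e^{-(t_1-t_0)}\le\|J_{\lambda(t_1)}x(t_1)-x(t_1)\|\le\|J_{\lambda(t_0)}x(t_0)-x(t_0)\|.$$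
   Context: $A^{-1}(0)=\{x\in\mathcal H: 0\in Ax\}$. For $\lambda>0$, $J_\lambda=(I+\lambda A)^{-1}:\mathcal H\to\mathcal H$ is the resolvent of $A$ of index $\lambda$. For $x\in\Omega=\mathcal H\setminus A^{-1}(0)$, $\Lambda_\theta(x)$ denotes the unique $\lambda>0$ such that $\lambda\|x-(I+\lambda A)^{-1}x\|=\theta$ (the function $\lambda\mapsto\lambda\|x-(I+\lambda A)^{-1}x\|$ is continuous and strictly increasing from $0$ to $+\infty$ for such $x$). A solution $x$ of the second (autonomous) problem takes its values in $\Omega$, and corresponds to $(x,\lambda)$ through $\lambda(t)=\Lambda_\theta(x(t))$. *)

(* Defs.v *)
From HB Require Import structures.
From mathcomp Require Import all_boot all_order all_algebra.
From mathcomp Require Import all_classical all_reals all_analysis.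

Set Implicit Arguments.
Unset Strict Implicit.
Unset Printing Implicit Defensive.

Import Order.TTheory GRing.Theory Num.Theory.
Import numFieldNormedType.Exports.

Local Open Scope classical_set_scope.
Local Open Scope ring_scope.

Section MonotoneOperators.
Context {R : realType} {H : completeNormedModType R}.

(* Set-valued operators H ⇉ H are functions H -> set H. *)
Definition monotone_op (dot : {dot H for (@idfun R)}) (A : H -> set H) : Prop :=
  forall x y u v : H, A x u -> A y v -> 0 <= dot (x - y) (u - v).

Definition maximal_monotone_op (dot : {dot H for (@idfun R)}) (A : H -> set H)
    : Prop :=
  monotone_op dot A /\
  forall B : H -> set H, monotone_op dot B ->
    (forall x, A x `<=` B x) -> forall x, B x `<=` A x.

(* H \ A^{-1}(0) *)
Definition nonzeros_op (A : H -> set H) : set H := ~` [set x | A x 0].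

(* The set-valued operator I + lam A *)
Definition id_add_op (lam : R) (A : H -> set H) : H -> set H :=
  fun y => [set y + lam *: v | v in A y].

(* J_lam = (I + lam A)^{-1}; for A maximal monotone and lam > 0 the set of
   preimages is a singleton (Minty), so the default value 0 is never used. *)
Definition resolvent (A : H -> set H) (lam : R) (x : H) : H :=
  xget 0 [set y | id_add_op lam A y x].

(* Lambda_theta(x); meaningful for theta > 0 and x outside A^{-1}(0), where
   the set below is a singleton. *)
Definition Lambda (A : H -> set H) (theta : R) (x : H) : R :=
  xget 0 [set lam | 0 < lam /\ lam * `|x - resolvent A lam x| = theta].

End MonotoneOperators.

Section HalfLine.
Context {R : realType} {V : normedModType R}.

(* Functions on [0, +oo[ are represented by functions on R of which only the
   values at t >= 0 matter.  [has_derive_ge0 x t v] says that x, as a function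
   on [0, +oo[, has derivative v at t: two-sided if t > 0, right if t = 0. *)
Definition has_derive_ge0 (x : R -> V) (t : R) (v : V) : Prop :=
  (s - t)^-1 *: (x s - x t) @[s --> within [set s : R | 0 <= s] t^'] --> v.

Definition C1_ge0 (x : R -> V) : Prop :=
  exists2 dx : R -> V,
    (forall t : R, 0 <= t -> has_derive_ge0 x t (dx t)) &
    {within [set t : R | 0 <= t], continuous dx}.

End HalfLine.

Section CauchyProblems.
Context {R : realType} {H : completeNormedModType R}.

Definition solution_pair (A : H -> set H) (theta : R) (x0 : H)
    (x : R -> H) (lam : R -> R) : Prop :=
  (forall t : R, 0 <= t ->
     [/\ exists2 dx, has_derive_ge0 x t dx &
           dx + x t - resolvent A (lam t) (x t) = 0,
         0 < lam t &
         lam t * `|resolvent A (lam t) (x t) - x t| = theta]) /\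
  x 0 = x0.

(* Since Lambda_theta is only defined on H \ A^{-1}(0), a solution of the
   autonomous problem is required to stay in that set. *)
Definition solution_autonomous (A : H -> set H) (theta : R) (x0 : H)
    (x : R -> H) : Prop :=
  (forall t : R, 0 <= t ->
     nonzeros_op A (x t) /\
     exists2 dx, has_derive_ge0 x t dx &
       dx + x t - resolvent A (Lambda A theta (x t)) (x t) = 0) /\
  x 0 = x0.

End CauchyProblems.

(* Main.v *)
Require Import Defs.
From HB Require Import structures.
From mathcomp Require Import all_boot all_order all_algebra.
From mathcomp Require Import all_classical all_reals all_analysis.
From mathcomp Require Import ring lra.

Set Implicit Arguments.
Unset Strict Implicit.
Unset Printing Implicit Defensive.

Import Order.TTheory GRing.Theory Num.Theory.
Import numFieldNormedType.Exports.

Local Open Scope classical_set_scope.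
Local Open Scope ring_scope.

(** Write [v x := J_Lambda(x) x - x] for the velocity of the autonomous
    problem.  The default values of [Lambda] and [resolvent] make [v] vanish on
    the zeros of [A], and the theorem holds because this extended velocity is
    tame on the whole space, not merely locally on the complement of the zeros.

    The resolvents are defined everywhere by Minty's theorem ([minty]), obtained
    by minimising the quadratically perturbed Fitzpatrick function of [A]; the
    minimiser exists by strong convexity and completeness alone.  Monotonicity
    then shows that [`|x - J_lam x|] is nondecreasing in [lam], while
    [`|x - J_lam x| / lam] is nonincreasing ([displacement_scale]).  Hence
    [lam * `|x - J_lam x|] takes the value [theta] exactly once off the zeros
    ([Lambda_spec], [Lambda_uniq]), and three estimates on the velocity follow:
    - [`|v x| = theta / Lambda x] is a 1-Lipschitz function of [x]
      ([norm_velocity_lip]);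
    - [v] is 2-Lipschitz ([velocity_lip]);
    - an explicit Euler step [x + h v x] with [h <= 1] does not increase [`|v|]
      ([norm_velocity_euler]).

    Because of the last two, the Euler polygons with meshes [2^-n] converge, and
    their limit is a global solution along which [`|v|] is nonincreasing and the
    distance travelled in time [t - s] is at most [(t - s) `|v (x s)|]
    ([euler_flow]).  Combined with the first estimate, this gives
    [`|v (x t)| >= (1 - (t - s)) `|v (x s)|]; subdividing [[s, t]] improves the
    factor to [e^(s - t)] ([expR_ge_of_rate]).  So the speed never vanishes, the
    solution never meets a zero of [A], and as [lambda = theta / `|v|] all the
    monotonicity and growth claims are statements about the speed.  Uniqueness
    is Gronwall's argument for a Lipschitz vector field
    ([lipschitz_ode_unique]). *)

(** * Sequences with a rate, and inner products *)

Section CauchySequences.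
Context {R : realType} {V : completeNormedModType R}.

Lemma cvg_of_rate (u : nat -> V) (e : nat -> R) :
  e n @[n --> \oo] --> 0 ->
  (forall m n, (m <= n)%N -> `|u m - u n| <= e m) -> cvg (u n @[n --> \oo]).
Proof.
move=> e0 ue; apply/cauchy_cvgP/cauchy_exP => _/posnumP[r].
have : \forall n \near \oo, e n < r%:num.
  by apply: (cvgr_lt 0).
move=> [N _ Ne]; exists (u N), N => // n /= Nn.
rewrite -ball_normE /ball_ /=.
exact: le_lt_trans (ue _ _ Nn) (Ne _ (leqnn N)).
Qed.

End CauchySequences.

Section InnerProduct.
Context {R : realType} {H : completeNormedModType R}.
Variable dot : {dot H for (@idfun R)}.
Hypothesis norm_dot : forall u : H, `|u| = Num.sqrt (dot u u).

Implicit Types u v w : H.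

Lemma dotC u v : dot u v = dot v u.
Proof. by rewrite hermC expr0 mul1r. Qed.

Lemma dotDl u v w : dot (u + v) w = dot u w + dot v w.
Proof. exact: linearDl. Qed.

Lemma dotDr u v w : dot w (u + v) = dot w u + dot w v.
Proof. exact: linearDr. Qed.

Lemma dotNl u w : dot (- u) w = - dot u w.
Proof. exact: linearNl. Qed.

Lemma dotNr u w : dot w (- u) = - dot w u.
Proof. exact: linearNr. Qed.

Lemma dotZl a u w : dot (a *: u) w = a * dot u w.
Proof. exact: linearZl_LR. Qed.

Lemma dotZr a u w : dot w (a *: u) = a * dot w u.
Proof. exact: linearZr_LR. Qed.

Lemma dotBl u v w : dot (u - v) w = dot u w - dot v w.
Proof. exact: linearBl. Qed.

Lemma dot0l u : dot 0 u = 0.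
Proof. exact: linear0l. Qed.

Definition dotE := (dotDl, dotDr, dotNl, dotNr, dotZl, dotZr).

Lemma dot_normsq u : dot u u = `|u| ^+ 2.
Proof.
rewrite norm_dot sqr_sqrtr//; have [->|u0] := eqVneq u 0; first by rewrite dot0l.
exact/ltW/neq0_dnorm_gt0.
Qed.

Lemma normsqD u v : `|u + v| ^+ 2 = `|u| ^+ 2 + 2 * dot u v + `|v| ^+ 2.
Proof. by rewrite -!dot_normsq !dotE (dotC v u); ring. Qed.

Lemma normsqB u v : `|u - v| ^+ 2 = `|u| ^+ 2 - 2 * dot u v + `|v| ^+ 2.
Proof. by rewrite normsqD dotNr normrN; ring. Qed.

Lemma normsqZ (a : R) (u : H) : `|a *: u| ^+ 2 = a ^+ 2 * `|u| ^+ 2.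
Proof. by rewrite -!dot_normsq !dotE; ring. Qed.

Lemma dot_le_norm u v : dot u v <= `|u| * `|v|.
Proof.
have : `|u + v| ^+ 2 <= (`|u| + `|v|) ^+ 2.
  by rewrite lerXn2r ?nnegrE ?addr_ge0// ler_normD.
rewrite normsqD sqrrD.
by rewrite -mulr_natl; lra.
Qed.

Lemma dot_norm_le u v : `|dot u v| <= `|u| * `|v|.
Proof.
rewrite ler_norml dot_le_norm andbT lerNl -dotNr -(normrN v).
exact: dot_le_norm.
Qed.

Lemma cvg_dot T (F : set_system T) (FF : Filter F) (f g : T -> H) a b :
  f x @[x --> F] --> a -> g x @[x --> F] --> b ->
  dot (f x) (g x) @[x --> F] --> dot a b.
Proof.
move=> fa gb; apply/subr_cvg0.
have dist0 (h : T -> H) c : h x @[x --> F] --> c -> `|h x - c| @[x --> F] --> 0.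
  by move=> hc; rewrite -(normr0 H) -(subrr c);
    apply: cvg_norm; exact: cvgB (cvg_cst c).
have bnd0 : `|f x - a| * `|g x| + `|a| * `|g x - b| @[x --> F] --> 0.
  rewrite -(addr0 0) -{2}(mulr0 `|a|) -{1}(mul0r `|b|).
  by apply: cvgD; apply: cvgM;
    [exact: dist0|exact: cvg_norm|exact: cvg_cst|exact: dist0].
apply: (@squeeze_cvgr _ _ _ _ (fun x => - (`|f x - a| * `|g x| + `|a| * `|g x - b|))
  (fun x => `|f x - a| * `|g x| + `|a| * `|g x - b|)).
- near=> x; rewrite -ler_norml.
  have -> : dot (f x) (g x) - dot a b = dot (f x - a) (g x) + dot a (g x - b).
    by rewrite !dotE; ring.
  by rewrite (le_trans (ler_normD _ _))// lerD// dot_norm_le.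
- by rewrite -oppr0; exact: cvgN.
- exact: bnd0.
Unshelve. all: by end_near.
Qed.

(** * Minty's theorem *)

Section Minty.
Variable A : H -> set H.
Hypothesis maxA : maximal_monotone_op dot A.

(** The graph of [A] enlarged by one point that is monotonically related to it
    is still monotone, so maximality puts the point in the graph. *)
Lemma maximal_mem p w :
  (forall y v, A y v -> 0 <= dot (y - p) (v - w)) -> A p w.
Proof.
move=> pw; case: (maxA) => monA /(_ (fun y => A y `|` [set v | y = p /\ v = w])).
apply; [|by move=> x v; left|by right].
move=> x y u v [Axu|[-> ->]] [Ayv|[-> ->]].
- exact: monA.
- exact: pw.
- by rewrite -opprB -(opprB v) dotNl dotNr opprK; apply: pw.
- by rewrite !subrr dot0l.
Qed.

Lemma maximal_nonempty : exists y v, A y v.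
Proof.
apply: contrapT => nA; apply: (nA); exists 0, 0; apply: maximal_mem => y v Ayv.
by exfalso; apply: nA; exists y, v.
Qed.

(** The epigraph of the Fitzpatrick function
    [(x, u) |-> sup (<x, v> + <y, u> - <y, v>)], the supremum being over the graph
    of [A]; working with it avoids infinite values of the supremum. *)
Let epi (x u : H) (r : R) :=
  forall y v, A y v -> dot x v + dot y u - dot y v <= r.

Let cost (x u : H) (r : R) := r + (`|x| ^+ 2 + `|u| ^+ 2) / 2.

(** By maximality the Fitzpatrick function dominates the duality pairing: below
    it, [(x, u)] would be strictly monotonically related to the graph, hence in
    the graph, where the function is equal to the pairing. *)
Let dot_le_epi x u r : epi x u r -> dot x u <= r.
Proof.
move=> E; rewrite leNgt; apply/negP => rlt.
have : A x u.
  apply: maximal_mem => y v Ayv; have := E y v Ayv.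
  by rewrite !dotE; lra.
by move=> /E; rewrite (addrK (dot x u)); lra.
Qed.

Let cost_ge0 x u r : epi x u r -> 0 <= cost x u r.
Proof.
move=> /dot_le_epi; have := sqr_ge0 `|x + u|; rewrite normsqD /cost; lra.
Qed.

Let epi_convex x u r y v s (t : R) : 0 <= t -> t <= 1 ->
  epi x u r -> epi y v s ->
  epi (x + t *: (y - x)) (u + t *: (v - u)) (r + t * (s - r)).
Proof.
move=> t0 t1 E1 E2 z w Azw; have e1 := E1 _ _ Azw; have e2 := E2 _ _ Azw.
rewrite !dotE; nra.
Qed.

(** Minimising sequences are Cauchy by strong convexity, as in the projection
    theorem. *)
Let exists_minimizer : exists x u r, epi x u r /\
  forall y v s, epi y v s -> cost x u r <= cost y v s.
Proof.
pose S := [set c | exists x u r, epi x u r /\ c = cost x u r].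
have hS : has_inf S.
  split; last by exists 0 => _ [x [u [r [E ->]]]]; exact: cost_ge0.
  have [y [v Ayv]] := maximal_nonempty.
  exists (cost y v (dot y v)), y, v, (dot y v); split => // z w Azw.
  by have := maxA.1 _ _ _ _ Ayv Azw; rewrite !dotE; lra.
(* [r] need not be followed along the minimising sequence: at the limit it is
   recovered from the infimum [m]. *)
pose m := inf S.
have mle x u r : epi x u r -> m <= cost x u r.
  by move=> E; apply: ge_inf; [exact: hS.2|exists x, u, r].
have /choice[f fP] : forall n : nat, exists xur : H * H * R,
    epi xur.1.1 xur.1.2 xur.2 /\
    cost xur.1.1 xur.1.2 xur.2 <= m + n.+1%:R^-1 ^+ 2.
  move=> n; have [||c [x [u [r [E ->]]]] clt] := @inf_adherent _ S (n.+1%:R^-1 ^+ 2).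
  - by rewrite exprn_gt0.
  - exact: hS.
  - by exists (x, u, r); split => //=; exact: ltW.
pose x n := (f n).1.1; pose u n := (f n).1.2; pose r n := (f n).2.
have E n : epi (x n) (u n) (r n) by case: (fP n).
have C n : cost (x n) (u n) (r n) <= m + n.+1%:R^-1 ^+ 2 by case: (fP n).
have sq k n : (k <= n)%N ->
    `|x k - x n| ^+ 2 + `|u k - u n| ^+ 2 <= (3 * k.+1%:R^-1) ^+ 2.
  move=> kn.
  have ln : n.+1%:R^-1 ^+ 2 <= k.+1%:R^-1 ^+ 2 :> R.
    by rewrite lerXn2r ?nnegrE// lef_pV2 ?posrE// ler_nat.
  have h0 : (0 : R) <= 2^-1 by lra.
  have h1 : (2^-1 : R) <= 1 by lra.
  have := mle _ _ _ (epi_convex h0 h1 (E k) (E n)).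
  have := C k; have := C n; rewrite /cost !normsqD !normsqZ !dotE !normsqB.
  rewrite !normrN !dot_normsq (dotC (x n)) (dotC (u n)) (exprMn _ 3).
  have := sqr_ge0 (k.+1%:R^-1 : R).
  move: ln; clear; set kk := k.+1%:R^-1 ^+ 2; set nn := n.+1%:R^-1 ^+ 2.
  lra.
have e0 : (3 * n.+1%:R^-1 : R) @[n --> \oo] --> 0.
  by rewrite -(mulr0 3); apply: cvgM; [exact: cvg_cst|exact: cvg_harmonic].
have xc : cvg (x n @[n --> \oo]).
  apply: (cvg_of_rate e0) => k n kn.
  rewrite -(ler_pXn2r (ltn0Sn 1)) ?nnegrE ?mulr_ge0//.
  by apply: le_trans (sq _ _ kn); rewrite lerDl sqr_ge0.
have uc : cvg (u n @[n --> \oo]).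
  apply: (cvg_of_rate e0) => k n kn.
  rewrite -(ler_pXn2r (ltn0Sn 1)) ?nnegrE ?mulr_ge0//.
  by apply: le_trans (sq _ _ kn); rewrite lerDr sqr_ge0.
move: xc uc => /cvg_ex[/= X xX] /cvg_ex[/= U uU].
exists X, U, (m - (`|X| ^+ 2 + `|U| ^+ 2) / 2); split; last first.
  by move=> y v s /mle; apply: le_trans; rewrite /cost subrK.
move=> y v Ayv.
have nsq (w : nat -> H) W : w n @[n --> \oo] --> W ->
    `|w n| ^+ 2 @[n --> \oo] --> `|W| ^+ 2.
  move=> wW; rewrite -dot_normsq; under eq_cvg do rewrite -dot_normsq.
  exact: cvg_dot.
apply: (@ler_cvg_to _ \oo _ _ (fun n => dot (x n) v + dot y (u n) - dot y v)
  (fun n => m + n.+1%:R^-1 ^+ 2 - (`|x n| ^+ 2 + `|u n| ^+ 2) / 2)).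
- apply: cvgB; last exact: cvg_cst.
  by apply: cvgD; apply: cvg_dot => //; exact: cvg_cst.
- apply: cvgB; last by apply: cvgM; [apply: cvgD; exact: nsq|exact: cvg_cst].
  rewrite -{2}(addr0 m); apply: cvgD; first exact: cvg_cst.
  rewrite -(mulr0 0); under eq_cvg do rewrite expr2.
  by apply: cvgM; exact: cvg_harmonic.
- apply: nearW => n; rewrite lerBrDr; apply: le_trans (C n).
  by rewrite lerD2r; exact: E.
Qed.

(** First-order optimality of a minimiser [(x, u)], tested against the points
    [(y, v)] of the graph, reads [`|x + u|^2 <= <y + u, v + x>].  Then
    [(- u, - x)] is in the graph by maximality, and testing against that very
    point gives [x = - u]. *)
Lemma minty_at_zero : exists p, A p (- p).
Proof.
have [x [u [r [E min]]]] := exists_minimizer.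
have xu : dot x u <= r := dot_le_epi E.
have key y v : A y v -> `|x + u| ^+ 2 <= dot (y + u) (v + x).
  move=> Ayv.
  have Ey : epi y v (dot y v).
    by move=> z w Azw; have := maxA.1 _ _ _ _ Ayv Azw; rewrite !dotE; lra.
  pose a := dot y v - r + dot x (y - x) + dot u (v - u).
  pose b := (`|y - x| ^+ 2 + `|v - u| ^+ 2) / 2.
  have lin t : 0 < t -> t <= 1 -> 0 <= a + t * b.
    move=> t0 t1; rewrite -(pmulr_rge0 _ t0) /a /b.
    have := min _ _ _ (epi_convex (ltW t0) t1 E Ey).
    by move: (y - x) (v - u) => p q; rewrite /cost !normsqD !normsqZ !dotZr; lra.
  suff : 0 <= a.
    by rewrite /a normsqD !dotE !dot_normsq (dotC y x) (dotC u x); lra.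
  rewrite leNgt; apply/negP => a0.
  have b0 : 0 <= b by rewrite divr_ge0// addr_ge0 ?sqr_ge0.
  (* A step small enough for the linear term [a < 0] to beat [t * b]. *)
  have t0 : 0 < - a / (b + 1 - a) by rewrite divr_gt0 //; lra.
  have t1 : - a / (b + 1 - a) <= 1 by rewrite ler_pdivrMr; lra.
  have := lin _ t0 t1; rewrite leNgt => /negP; apply.
  have : 0 < b + 1 - a by lra.
  set c := b + 1 - a => c0.
  rewrite -(pmulr_rlt0 _ c0) mulrDr mulrA (mulrC c (_ / _)) divfK ?gt_eqF//.
  by rewrite /c; nra.
have Aux : A (- u) (- x).
  apply: maximal_mem => y v /key; rewrite !opprK; apply: le_trans.
  exact: sqr_ge0.
have := key _ _ Aux; rewrite !addNr dot0l => /le_gtF.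
move=> /negbT; rewrite exprn_even_gt0 //= negbK normr_eq0 addr_eq0 => /eqP xNu.
by exists (- u); rewrite opprK; move: Aux; rewrite xNu opprK.
Qed.

End Minty.

(** Solving [y + lam v = x] with [v] in [A y] is the case [lam = 1], [x = 0] for
    the operator [lam A (. + x)]. *)
Lemma maximal_scale_shift (A : H -> set H) (lam : R) (x : H) : 0 < lam ->
  maximal_monotone_op dot A ->
  maximal_monotone_op dot (fun y => [set lam *: v | v in A (y + x)]).
Proof.
move=> lam0 maxA; split.
  move=> y z _ _ [u Au <-] [v Av <-]; rewrite -scalerBr dotZr pmulr_rge0//.
  have -> : y - z = (y + x) - (z + x) by rewrite opprD addrACA subrr addr0.
  exact: (maxA.1 _ _ _ _ Au Av).
move=> B monB AB y w Byw; exists (lam^-1 *: w); last first.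
  by rewrite scalerA divff ?scale1r// gt_eqF.
apply: (maximal_mem maxA) => z v Azv.
have : B (z - x) (lam *: v) by apply: AB; exists v; rewrite ?subrK.
move=> Bzv; rewrite -(pmulr_rge0 _ lam0) -dotZr scalerBr scalerA.
rewrite divff ?gt_eqF// scale1r opprD (addrC (- y)) addrA.
exact: (monB _ _ _ _ Bzv Byw).
Qed.

Lemma minty (A : H -> set H) (lam : R) (x : H) : 0 < lam ->
  maximal_monotone_op dot A -> exists p v, A p v /\ p + lam *: v = x.
Proof.
move=> lam0 maxA.
have [p [v Av vp]] := minty_at_zero (maximal_scale_shift x lam0 maxA).
by exists (p + x), v; split=> //; rewrite vp addrAC subrr add0r.
Qed.

End InnerProduct.

(** * Resolvents *)

Section Resolvent.
Context {R : realType} {H : completeNormedModType R}.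
Variable dot : {dot H for (@idfun R)}.
Hypothesis norm_dot : forall u : H, `|u| = Num.sqrt (dot u u).
Variable A : H -> set H.
Hypothesis maxA : maximal_monotone_op dot A.
Implicit Types (x y p v : H) (lam mu : R).

Local Notation J := (resolvent A).

Lemma resolvent_mem lam x : 0 < lam -> A (J lam x) (lam^-1 *: (x - J lam x)).
Proof.
move=> lam0; have [p [v [Apv pvx]]] := minty norm_dot x lam0 maxA.
have : [set y | id_add_op lam A y x] (J lam x).
  by apply: xgetPex; exists p, v.
case=> w Aw wx; suff -> : x - J lam x = lam *: w.
  by rewrite scalerA mulVf ?gt_eqF// scale1r.
by rewrite -{1}wx addrC addKr.
Qed.

(** Firm nonexpansiveness of [I - J_lam], i.e. cocoercivity of the Yosida
    approximation; it carries all the Lipschitz estimates below. *)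
Lemma displacement_firm lam x y : 0 < lam ->
  `|(x - J lam x) - (y - J lam y)| ^+ 2 <=
  dot ((x - J lam x) - (y - J lam y)) (x - y).
Proof.
move=> lam0.
have := maxA.1 _ _ _ _ (resolvent_mem x lam0) (resolvent_mem y lam0).
rewrite -scalerBr dotZr pmulr_rge0 ?invr_gt0// dotC.
set d := (x - J lam x) - (y - J lam y); set e := J lam x - J lam y => de.
have -> : x - y = d + e.
  by rewrite -{1}(subrK (J lam x) x) -{1}(subrK (J lam y) y) opprD addrACA.
by rewrite dotDr (dot_normsq norm_dot) lerDl.
Qed.

Lemma displacement_nonexpansive lam x y : 0 < lam ->
  `|(x - J lam x) - (y - J lam y)| <= `|x - y|.
Proof.
move=> lam0; set d := (x - J lam x) - (y - J lam y).
have := le_trans (displacement_firm x y lam0) (dot_le_norm norm_dot _ _).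
rewrite -/d; have [->|d0] := eqVneq d 0; first by rewrite normr0.
by rewrite expr2 ler_pM2l// normr_gt0.
Qed.

Lemma resolvent_nonexpansive lam x y : 0 < lam ->
  `|J lam x - J lam y| <= `|x - y|.
Proof.
move=> lam0; have := displacement_firm x y lam0.
have -> : (x - J lam x) - (y - J lam y) = (x - y) - (J lam x - J lam y).
  by rewrite !opprD addrACA.
move: (x - y) (J lam x - J lam y) => a b.
rewrite (normsqB norm_dot) dotBl (dot_normsq norm_dot) (dotC dot b a) => H1.
have : `|b| ^+ 2 <= `|a| * `|b|.
  by have := dot_le_norm norm_dot a b; lra.
have [->|b0] := eqVneq b 0; first by rewrite normr0.
by rewrite expr2 ler_pM2r// normr_gt0.
Qed.

Lemma resolvent_uniq lam p v : 0 < lam -> A p v -> J lam (p + lam *: v) = p.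
Proof.
move=> lam0 Apv; set x := p + _.
have := maxA.1 _ _ _ _ (resolvent_mem x lam0) Apv.
have -> : lam^-1 *: (x - J lam x) - v = lam^-1 *: (p - J lam x).
  rewrite /x addrAC scalerDr scalerA mulVf ?gt_eqF// scale1r.
  by rewrite addrK.
rewrite dotZr pmulr_rge0 ?invr_gt0// -opprB dotNl (dot_normsq norm_dot) oppr_ge0.
move=> h; apply/esym/eqP; rewrite -subr_eq0 -normr_eq0 -sqrf_eq0.
by rewrite eq_le h sqr_ge0.
Qed.

Lemma resolvent_zero lam x : 0 < lam -> A x 0 -> J lam x = x.
Proof.
by move=> lam0 Ax0; rewrite -{1}(addr0 x) -(scaler0 _ lam) resolvent_uniq.
Qed.

Lemma displacement_gt0 lam x : 0 < lam -> nonzeros_op A x -> 0 < `|x - J lam x|.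
Proof.
move=> lam0 nAx; rewrite normr_gt0; apply/negP => /eqP xJ; apply: nAx => /=.
have := resolvent_mem x lam0; rewrite xJ scaler0.
by move/subr0_eq : xJ => <-.
Qed.

(** With the Yosida vectors [a] and [b] at the indices [lam] and [mu],
    monotonicity of [A] between the two resolvents becomes
    [0 <= (mu `|b| - lam `|a|) (`|a| - `|b|)], and both comparisons follow by
    looking at the signs of the factors. *)
Lemma displacement_scale lam mu x : 0 < lam -> lam <= mu ->
  `|x - J lam x| <= `|x - J mu x| /\ lam * `|x - J mu x| <= mu * `|x - J lam x|.
Proof.
move=> lam0 lm; have mu0 : 0 < mu := lt_le_trans lam0 lm.
pose a := lam^-1 *: (x - J lam x); pose b := mu^-1 *: (x - J mu x).
have ea : x - J lam x = lam *: a by rewrite scalerA divff ?scale1r ?gt_eqF.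
have eb : x - J mu x = mu *: b by rewrite scalerA divff ?scale1r ?gt_eqF.
have := maxA.1 _ _ _ _ (resolvent_mem x lam0) (resolvent_mem x mu0).
rewrite -/a -/b.
have -> : J lam x - J mu x = mu *: b - lam *: a.
  by rewrite -ea -eb opprB [RHS]addrC addrA subrK.
clearbody a b; rewrite ea eb !normrZ (gtr0_norm lam0) (gtr0_norm mu0).
rewrite !dotE !(dot_normsq norm_dot) (dotC dot b a).
have := dot_le_norm norm_dot a b; have := normr_ge0 a; have := normr_ge0 b.
move: (dot a b) (`|a|) (`|b|) => d r s s0 r0 drs h.
have key : 0 <= (mu * s - lam * r) * (r - s) by nra.
have sr : s <= r.
  rewrite leNgt; apply/negP => rs.
  have : 0 < mu * s - lam * r.
    by rewrite subr_gt0 (lt_le_trans _ (ler_wpM2r s0 lm))// ltr_pM2l.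
  by move: key => /[swap] => /pmulr_rge0 ->; lra.
have : lam * r <= mu * s.
  move: sr; rewrite le_eqVlt => /predU1P[->|sr]; first by rewrite ler_wpM2r.
  by rewrite -subr_ge0 -(pmulr_lge0 _ (_ : 0 < r - s))// subr_gt0.
by move=> ?; split => //; rewrite mulrCA !ler_pM2l.
Qed.

(** The resolvent identity
    [J_mu x = J_lam (J_mu x + (lam / mu) (x - J_mu x))], followed by
    nonexpansiveness of [J_lam]. *)
Lemma resolvent_index_dist lam mu x : 0 < lam -> lam <= mu ->
  `|J lam x - J mu x| <= (1 - lam / mu) * `|x - J mu x|.
Proof.
move=> lam0 lm; have mu0 : 0 < mu := lt_le_trans lam0 lm.
set q := J mu x.
have qE : q = J lam (q + (lam / mu) *: (x - q)).
  by rewrite -scalerA resolvent_uniq//; exact: resolvent_mem.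
rewrite {1}qE; apply: le_trans (resolvent_nonexpansive _ _ lam0) _.
have r0 : 0 <= 1 - lam / mu by rewrite subr_ge0 ler_pdivrMr// mul1r.
by rewrite opprD addrA -{1}(scale1r (x - q)) -scalerBl normrZ (ger0_norm r0).
Qed.

End Resolvent.

(** * The index Lambda and the velocity of the flow *)

Section Velocity.
Context {R : realType}.

Lemma lipschitz_within_continuous (V : normedModType R) (D : set R)
    (f : R -> V) (K : R) :
  (forall s t, D s -> D t -> `|f s - f t| <= K * `|s - t|) ->
  {within D, continuous f}.
Proof.
move=> fK; apply/subspace_continuousP => t Dt; apply/cvgrPdist_le => e e0.
rewrite near_withinE; apply/nbhs_ballP.
have K0 : 0 < `|K| + 1 by rewrite ltr_wpDl.
exists (e / (`|K| + 1)); first exact: divr_gt0.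
move=> s; rewrite -ball_normE /= ltr_pdivlMr// => ts Ds.
apply: le_trans (fK _ _ Dt Ds) _; apply: le_trans (ltW ts).
by rewrite mulrC ler_wpM2l// (le_trans (ler_norm K))// lerDl.
Qed.

Context {H : completeNormedModType R}.
Variable dot : {dot H for (@idfun R)}.
Hypothesis norm_dot : forall u : H, `|u| = Num.sqrt (dot u u).
Variable A : H -> set H.
Hypothesis maxA : maximal_monotone_op dot A.
Variable theta : R.
Hypothesis theta_gt0 : 0 < theta.
Implicit Types (x y p v : H) (lam mu : R).

Local Notation J := (resolvent A).
Local Notation L := (Lambda A theta).

(** The intermediate value theorem applied to [lam * `|x - J_lam x|], which by
    [displacement_scale] grows at least linearly beyond [1] and is at most linear
    below [1]; the same comparison shows that it is Lipschitz on compact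
    intervals of positive indices. *)
Lemma index_exists x : nonzeros_op A x ->
  exists lam, 0 < lam /\ lam * `|x - J lam x| = theta.
Proof.
move=> nAx; have mono := displacement_scale norm_dot maxA x.
set c := `|x - J 1 x|.
have c0 : 0 < c by exact: (displacement_gt0 norm_dot maxA).
have tc0 : 0 < theta / c by exact: divr_gt0.
pose a := Num.min 1 (theta / c); pose b := Num.max 1 (theta / c).
have a0 : 0 < a by rewrite lt_min ltr01.
have a1 : a <= 1 by rewrite ge_min lexx.
have b1 : 1 <= b by rewrite le_max lexx.
have ab : a <= b := le_trans a1 b1.
pose phi lam := lam * `|x - J lam x|.
have phia : phi a <= theta.
  apply: (@le_trans _ _ (a * c)).
    by rewrite ler_wpM2l ?(ltW a0)//; case: (mono a 1).
  by rewrite -ler_pdivlMr// ge_min lexx orbT.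
have phib : theta <= phi b.
  apply: (@le_trans _ _ (b * c)); first by rewrite -ler_pdivrMr// le_max lexx orbT.
  by rewrite ler_wpM2l ?(le_trans _ b1)//; case: (mono 1 b).
have lip s t : a <= s -> s <= t -> t <= b ->
    0 <= phi t - phi s <= (2 * b / a * `|x - J b x|) * (t - s).
  move=> as_ st tb; have s0 : 0 < s := lt_le_trans a0 as_.
  have [m1 m2] := mono _ _ s0 st; have [m3 _] := mono _ _ s0 (le_trans st tb).
  have dsx := normr_ge0 (x - J s x); apply/andP; split.
    by rewrite subr_ge0 /phi ler_pM// ltW.
  have ba : t + s <= s * (2 * b / a).
    rewrite -mulrA mulrCA; apply: (@le_trans _ _ (2 * b)); first lra.
    by rewrite ler_pM2l// mulrCA ler_peMr ?(le_trans _ b1)// ler_pdivlMr ?mul1r.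
  rewrite -(ler_pM2l s0); apply: (@le_trans _ _ ((t + s) * (t - s) * `|x - J s x|)).
    by rewrite /phi; nra.
  apply: (@le_trans _ _ (s * (2 * b / a) * (t - s) * `|x - J s x|)).
    by rewrite ler_wpM2r// ler_wpM2r// subr_ge0.
  rewrite [leRHS](_ : _ = s * (2 * b / a) * (t - s) * `|x - J b x|); last by ring.
  rewrite ler_wpM2l// mulr_ge0// ?subr_ge0// mulr_ge0 ?(ltW s0)//.
  by rewrite divr_ge0 ?(ltW a0)// mulr_ge0// (le_trans _ b1).
have cphi : {within `[a, b], continuous phi}.
  apply: (@lipschitz_within_continuous _ _ _ (2 * b / a * `|x - J b x|)) => s t.
  rewrite /= !in_itv /= => /andP[as_ sb] /andP[at_ tb].
  have [st|/ltW ts] := leP s t.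
    have /andP[p0 pK] := lip _ _ as_ st tb.
    by rewrite distrC (ger0_norm p0) (distrC s) (@ger0_norm _ (t - s))// subr_ge0.
  have /andP[p0 pK] := lip _ _ at_ ts sb.
  by rewrite (ger0_norm p0) (@ger0_norm _ (s - t))// subr_ge0.
have phiab : phi a <= phi b := le_trans phia phib.
have [|lam] := @IVT _ phi a b theta ab cphi.
  by rewrite (min_l phiab) (max_r phiab) phia phib.
rewrite in_itv /= => /andP[al _] <-; exists lam; split => //.
exact: lt_le_trans al.
Qed.

Lemma index_lt x lam mu : nonzeros_op A x -> 0 < lam -> lam < mu ->
  lam * `|x - J lam x| < mu * `|x - J mu x|.
Proof.
move=> nAx lam0 lm; have [le _] := displacement_scale norm_dot maxA x lam0 (ltW lm).
apply: (lt_le_trans (y := mu * `|x - J lam x|)).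
  by rewrite ltr_pM2r//; exact: (displacement_gt0 norm_dot maxA).
by rewrite ler_pM2l// (lt_trans lam0).
Qed.

Lemma Lambda_spec x : nonzeros_op A x ->
  0 < L x /\ L x * `|x - J (L x) x| = theta.
Proof. by move=> /index_exists ex; exact: (xgetPex 0 ex). Qed.

Lemma index_nonzero x lam : lam * `|x - J lam x| = theta -> 0 < lam ->
  nonzeros_op A x.
Proof.
move=> e lam0 /= Ax0; move: theta_gt0; rewrite -e.
by rewrite (resolvent_zero norm_dot maxA lam0 Ax0) subrr normr0 mulr0 ltxx.
Qed.

Lemma Lambda_uniq x lam : 0 < lam -> lam * `|x - J lam x| = theta -> L x = lam.
Proof.
move=> lam0 e; have nAx := index_nonzero e lam0.
have [L0 eL] := Lambda_spec nAx.
have [h|h|//] := ltgtP (L x) lam.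
- by have := index_lt nAx L0 h; rewrite e eL ltxx.
- by have := index_lt nAx lam0 h; rewrite e eL ltxx.
Qed.

Lemma Lambda_zero x : A x 0 -> L x = 0.
Proof.
move=> Ax0; apply: xgetPN => lam [lam0 e].
exact: (index_nonzero e lam0 Ax0).
Qed.

(** At a zero of [A], no index qualifies and [L x = 0]; since [J 0] is the
    identity on the domain of [A], the velocity is then [0], which extends the
    vector field continuously. *)
Definition velocity x := J (L x) x - x.
Local Notation F := velocity.

Lemma velocity_zero x : A x 0 -> F x = 0.
Proof.
move=> Ax0; rewrite /velocity (Lambda_zero Ax0).
have : [set y | id_add_op 0 A y x] (J 0 x).
  by apply: xgetPex; exists x, 0; rewrite ?scaler0 ?addr0.
by case=> v _; rewrite scale0r addr0 => ->; rewrite subrr.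
Qed.

Lemma norm_velocity x : `|F x| = theta / L x.
Proof.
have [Ax0|/Lambda_spec[L0 e]] := pselect (A x 0).
  by rewrite velocity_zero// Lambda_zero// invr0 mulr0 normr0.
by rewrite -[X in X / _]e mulrC mulKf ?gt_eqF// distrC.
Qed.

Lemma norm_velocity_gt0 x : nonzeros_op A x -> 0 < `|F x|.
Proof. by move=> /Lambda_spec[L0 _]; rewrite norm_velocity divr_gt0. Qed.

(** Compare both displacements at the index [L x] with
    [displacement_nonexpansive]; if [L y < L x] there is nothing to compare, as
    the speed [theta / L x] is then smaller than [theta / L y]. *)
Lemma norm_velocity_lip x y : `|F x| <= `|F y| + `|x - y|.
Proof.
have [Ax0|/Lambda_spec[lam0 ex]] := pselect (A x 0).
  by rewrite velocity_zero// normr0 addr_ge0.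
set lam := L x in lam0 ex.
have step : `|F x| <= `|y - J lam y| + `|x - y|.
  rewrite distrC -/lam -lerBlDl; apply: le_trans (lerB_dist _ _) _.
  exact: (displacement_nonexpansive norm_dot maxA).
have [Ay0|/Lambda_spec[mu0 ey]] := pselect (A y 0).
  apply: le_trans step _; rewrite lerD2r.
  by rewrite (resolvent_zero norm_dot maxA lam0 Ay0) subrr normr0.
have [lm|ml] := leP lam (L y).
  apply: le_trans step _; rewrite lerD2r /F [leRHS]distrC.
  by case: (displacement_scale norm_dot maxA y lam0 lm).
rewrite !norm_velocity -/lam (le_trans (y := theta / L y))// ?lerDl//.
by rewrite ler_pM2l// lef_pV2 ?posrE// ltW.
Qed.

(** Passing from [x] to [y] at the index [L x] costs [`|x - y|].  For
    [L x <= L y], changing the index at [y] from [L x] to [L y] costs at most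
    [(L x / L y) (`|v x| - `|v y|)] by [resolvent_index_dist], and this is bounded
    by [`|x - y|] again, by [norm_velocity_lip]. *)
Lemma velocity_lip x y : `|F x - F y| <= 2 * `|x - y|.
Proof.
have [Ax0|/Lambda_spec[lam0 ex]] := pselect (A x 0).
  rewrite (velocity_zero Ax0) sub0r normrN (le_trans (norm_velocity_lip y x))//.
  by rewrite (velocity_zero Ax0) normr0 add0r distrC ler_peMl// ler1n.
have [Ay0|/Lambda_spec[mu0 ey]] := pselect (A y 0).
  rewrite (velocity_zero Ay0) subr0 (le_trans (norm_velocity_lip x y))//.
  by rewrite (velocity_zero Ay0) normr0 add0r ler_peMl// ler1n.
wlog lm : x y lam0 mu0 ex ey / L x <= L y.
  move=> W; have [h|/ltW h] := leP (L x) (L y); first exact: W.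
  by rewrite distrC (distrC x); exact: W.
set lam := L x in lam0 ex lm; set mu := L y in mu0 ey lm.
have -> : F x - F y = ((y - J lam y) - (x - J lam x)) + (J lam y - J mu y).
  by rewrite /F !opprB [RHS]addrAC (addrA (y - _)) subrK [RHS]addrC.
apply: le_trans (ler_normD _ _) _; rewrite mulr_natl mulr2n lerD//.
  by rewrite (distrC x); exact: (displacement_nonexpansive norm_dot maxA).
apply: le_trans (resolvent_index_dist norm_dot maxA y lam0 lm) _.
apply: le_trans (_ : `|F x| - `|F y| <= _).
  2: by rewrite lerBlDl norm_velocity_lip.
rewrite !norm_velocity -/lam -/mu.
have -> : `|y - J mu y| = theta / mu by rewrite -ey mulrC mulKf ?gt_eqF.
have -> : (1 - lam / mu) * (theta / mu) = lam / mu * (theta / lam - theta / mu).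
  by field; rewrite !gt_eqF.
rewrite ler_piMl ?ler_pdivrMr ?mul1r// subr_ge0.
by rewrite ler_pM2l// lef_pV2 ?posrE.
Qed.

(** At the fixed index [L x], cocoercivity shows that the step shortens the
    displacement; so at the new point the index cannot be smaller than [L x],
    and the speed [theta / L] cannot be larger. *)
Lemma norm_velocity_euler x (h : R) : 0 <= h -> h <= 1 ->
  `|F (x + h *: F x)| <= `|F x|.
Proof.
move=> h0 h1; have [->|hn0] := eqVneq h 0; first by rewrite scale0r addr0.
have [Ax0|/Lambda_spec[lam0 ex]] := pselect (A x 0).
  by rewrite (velocity_zero Ax0) scaler0 addr0 (velocity_zero Ax0).
set lam := L x in lam0 ex; set y := x + _.
have [Ay0|/Lambda_spec[mu0 ey]] := pselect (A y 0).
  by rewrite (velocity_zero Ay0) normr0.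
rewrite !norm_velocity -/lam ler_pM2l// lef_pV2 ?posrE// leNgt; apply/negP => ml.
have [m1 _] := displacement_scale norm_dot maxA y mu0 (ltW ml).
suff : `|y - J lam y| <= `|x - J lam x|.
  move=> m2; have : L y * `|y - J (L y) y| < lam * `|x - J lam x|.
    apply: lt_le_trans (_ : lam * `|y - J (L y) y| <= _).
      rewrite ltr_pM2r// normr_gt0; apply/eqP => d0; move: theta_gt0.
      by rewrite -ey d0 normr0 mulr0 ltxx.
    by rewrite ler_pM2l// (le_trans m1).
  by rewrite ex ey ltxx.
have := displacement_firm norm_dot maxA y x lam0.
have -> : y - x = - h *: (x - J lam x).
  by rewrite /y addrC addKr scaleNr -scalerN opprB.
move: (x - J lam x) (y - J lam y) => d e.
move=> H1; rewrite -(ler_pXn2r (ltn0Sn 1)) ?nnegrE//; move: H1.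
have := sqr_ge0 `|e - d|.
rewrite (normsqB norm_dot) !dotE !(dot_normsq norm_dot).
have hp : 0 < h by rewrite lt_neqAle eq_sym hn0.
move: (dot e d) (`|e| ^+ 2) (`|d| ^+ 2) => c p q s0 s1.
have cq : c <= q by rewrite -subr_le0 -(pmulr_rle0 _ hp); lra.
nra.
Qed.

End Velocity.

(** * Convergence of the explicit Euler scheme *)

Section Euler.
Context {R : realType} {V : completeNormedModType R}.
Variables (F : V -> V) (K : R).
Hypothesis K0 : 0 <= K.
Hypothesis F_lip : forall x y, `|F x - F y| <= K * `|x - y|.
Hypothesis F_decr : forall x (h : R), 0 <= h -> h <= 1 ->
  `|F (x + h *: F x)| <= `|F x|.

Definition euler_step (h : R) (x : V) := x + h *: F x.

Definition euler (h : R) (x0 : V) (n : nat) := iter n (euler_step h) x0.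

Section Step.
Variables (h : R) (x0 : V).
Hypotheses (h0 : 0 <= h) (h1 : h <= 1).

Local Notation E := (euler h x0).

Lemma euler_speed_decr k j : `|F (E (j + k))| <= `|F (E k)|.
Proof. by elim: j => // j /(le_trans _); apply; exact: F_decr. Qed.

Lemma euler_dist k j : `|E (j + k) - E k| <= j%:R * h * `|F (E k)|.
Proof.
elim: j => [|j IH]; first by rewrite subrr normr0 mul0r mul0r.
rewrite addSn /= /euler_step addrAC (le_trans (ler_normD _ _))//.
rewrite -natr1 2!mulrDl mul1r lerD// normrZ ger0_norm// ler_wpM2l//.
exact: euler_speed_decr.
Qed.

Lemma euler_taylor k j :
  `|E (j + k) - E k - (j%:R * h) *: F (E k)| <= K * (j%:R * h) ^+ 2 * `|F (E k)|.
Proof.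
elim: j => [|j IH].
  by rewrite subrr mul0r scale0r subrr normr0 mulr_ge0// mulr_ge0// sqr_ge0.
set a := `|F (E k)| in IH *; have a0 : 0 <= a := normr_ge0 _.
have -> : E (j.+1 + k) - E k - (j.+1%:R * h) *: F (E k) =
    (E (j + k) - E k - (j%:R * h) *: F (E k)) + h *: (F (E (j + k)) - F (E k)).
  rewrite addSn /= /euler_step -natr1 mulrDl mul1r scalerDl scalerBr opprD.
  by rewrite (addrAC (E (j + k))) addrACA.
apply: le_trans (ler_normD _ _) _.
have h2 : `|h *: (F (E (j + k)) - F (E k))| <= h * (K * (j%:R * h * a)).
  rewrite normrZ ger0_norm// ler_wpM2l// (le_trans (F_lip _ _))// ler_wpM2l//.
  exact: euler_dist.
apply: le_trans (lerD IH h2) _; rewrite -natr1.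
have -> : K * ((j%:R + 1) * h) ^+ 2 * a =
    K * (j%:R * h) ^+ 2 * a + h * (K * (j%:R * h * a)) + K * h ^+ 2 * (j%:R + 1) * a.
  by ring.
by rewrite lerDl !mulr_ge0// ?sqr_ge0// addr_ge0.
Qed.

End Step.

(** One step of length [2h] and two steps of length [h] from the same point
    differ by [h (F y - F (y + h F y))], which is [O(h^2)]; earlier errors are
    amplified by the factor [1 + 2hK <= e^(2hK)] at each step. *)
Lemma euler_halving (h : R) x0 k : 0 <= h -> 2 * h <= 1 ->
  `|euler (2 * h) x0 k - euler h x0 (2 * k)| <=
  k%:R * (K * h ^+ 2 * `|F x0|) * expR (2 * h * K * k%:R).
Proof.
move=> h0 h1; have h2 : h <= 1 by lra.
elim: k => [|k IH]; first by rewrite muln0 subrr normr0 !mul0r.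
set x := euler (2 * h) x0 k in IH *; set y := euler h x0 (2 * k) in IH *.
have -> : euler (2 * h) x0 k.+1 - euler h x0 (2 * k.+1) =
   (x - y) + (2 * h) *: (F x - F y) + h *: (F y - F (euler_step h y)).
  rewrite mulnS /= -/y -/x {1 2}/euler_step {1}/euler_step.
  rewrite !scalerBr (_ : (2 * h) *: F y = h *: F y + h *: F y); last first.
    by rewrite mulr_natl mulr2n scalerDl.
  move: (F (y + _)) ((2 * h) *: F x) (h *: F y) => r p q.
  rewrite -[RHS]addrA (opprD q) -(addrA p) (addrA (- q - q)) subrK.
  by rewrite -(addrA y) opprD addrACA opprD.
set c := K * h ^+ 2 * `|F x0| in IH *.
have c0 : 0 <= c by rewrite !mulr_ge0// sqr_ge0.
set e := 2 * h * K; have e0 : 0 <= e by rewrite !mulr_ge0.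
have A1 : `|h *: (F y - F (euler_step h y))| <= c.
  rewrite normrZ ger0_norm// /c.
  rewrite (_ : K * h ^+ 2 * _ = h * (K * (h * `|F x0|))); last by ring.
  rewrite ler_wpM2l// (le_trans (F_lip _ _))// ler_wpM2l// /euler_step opprD addNKr.
  rewrite normrN normrZ ger0_norm// ler_wpM2l//.
  by have := euler_speed_decr x0 h0 h2 0 (2 * k); rewrite addn0.
have A2 : `|(2 * h) *: (F x - F y)| <= e * `|x - y|.
  rewrite normrZ ger0_norm ?mulr_ge0// /e -mulrA ler_wpM2l ?mulr_ge0//.
have A3 : `|x - y| * (1 + e) <= k%:R * c * expR (e * k.+1%:R).
  have -> : expR (e * k.+1%:R) = expR (e * k%:R) * expR e.
    by rewrite -natr1 mulrDr mulr1 expRD.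
  by rewrite mulrA ler_pM// ?addr_ge0// expR_ge1Dx.
have A4 : c <= c * expR (e * k.+1%:R).
  rewrite ler_peMr// (le_trans _ (expR_ge1Dx _))// lerDl mulr_ge0//.
apply: le_trans (ler_normD _ _) _.
apply: (@le_trans _ _ (`|x - y| * (1 + e) + c)).
  by rewrite lerD// mulrDr mulr1 (le_trans (ler_normD _ _))// lerD// [leRHS]mulrC.
have -> : k.+1%:R * c * expR (e * k.+1%:R) =
    k%:R * c * expR (e * k.+1%:R) + c * expR (e * k.+1%:R).
  by rewrite -natr1; move: (expR _) => z; ring.
exact: lerD.
Qed.

Definition mesh (n : nat) : R := 2^-1 ^+ n.

Lemma mesh_gt0 n : 0 < mesh n.
Proof. by rewrite exprn_gt0. Qed.

Lemma mesh_le1 n : mesh n <= 1.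
Proof. by rewrite exprn_ile1// invf_le1// ler1n. Qed.

Lemma meshS n : 2 * mesh n.+1 = mesh n.
Proof. by rewrite /mesh exprS mulrA divff ?mul1r. Qed.

Lemma cvg_mesh : mesh n @[n --> \oo] --> 0.
Proof. by apply: cvg_expr; rewrite ger0_norm// invf_lt1// ltr1n. Qed.

Definition cell (n : nat) (t : R) := Num.truncn (t / mesh n).

Lemma cell_itv n (t : R) : 0 <= t ->
  (cell n t)%:R * mesh n <= t < (cell n t)%:R * mesh n + mesh n.
Proof.
move=> t0; have := truncn_itv (divr_ge0 t0 (ltW (mesh_gt0 n))).
by rewrite ler_pdivlMr ?mesh_gt0// ltr_pdivrMr ?mesh_gt0// -natr1 mulrDl mul1r.
Qed.

Lemma cellS n (t : R) : 0 <= t ->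
  exists2 b : nat, (b <= 1)%N & cell n.+1 t = (b + 2 * cell n t)%N.
Proof.
move=> t0; have := cell_itv n t0; rewrite -meshS.
set k := cell n t; set m := mesh n.+1 => /andP[k1 k2].
have m0 : 0 < m by exact: mesh_gt0.
have l1 : (2 * k <= cell n.+1 t)%N.
  rewrite truncn_ge_nat ?divr_ge0 ?(ltW m0)// ler_pdivlMr//.
  by rewrite natrM -/m; lra.
have l2 : (cell n.+1 t <= 1 + 2 * k)%N.
  rewrite truncn_le_nat ltr_pdivrMr//.
  by rewrite -natr1 natrD natrM -/m; lra.
exists (cell n.+1 t - 2 * k)%N; first by rewrite leq_subLR addnC.
by rewrite subnK.
Qed.

Lemma cell_homo n (s t : R) : s <= t -> (cell n s <= cell n t)%N.
Proof.
by move=> st; apply: le_truncn; rewrite ler_pM2r// invr_gt0 mesh_gt0.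
Qed.

Variable x0 : V.

Definition euler_path (n : nat) (t : R) : V := euler (mesh n) x0 (cell n t).

Lemma euler_path_refine n (t : R) : 0 <= t ->
  `|euler_path n t - euler_path n.+1 t| <=
  ((t * K * expR (K * t) + 1) * `|F x0|) * (mesh n - mesh n.+1).
Proof.
move=> t0; have [b b1 ebk] := cellS n t0.
have m0 := mesh_gt0 n.+1; have m1 := mesh_le1 n.+1.
have -> : mesh n - mesh n.+1 = mesh n.+1 by rewrite -meshS; ring.
rewrite /euler_path ebk.
set k := cell n t; set m := mesh n.+1.
apply: le_trans (ler_distD (euler m x0 (2 * k)) _ _) _.
have km : k%:R * (2 * m) <= t by case/andP: (cell_itv n t0); rewrite -meshS.
have k0 : 0 <= k%:R :> R by [].
have K1 : K * (k%:R * (2 * m)) <= K * t by rewrite ler_wpM2l.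
have h1 : 2 * m <= 1 by rewrite meshS mesh_le1.
have F0 := normr_ge0 (F x0).
apply: (@le_trans _ _ (t * K * expR (K * t) * `|F x0| * m + `|F x0| * m)); last first.
  by rewrite -mulrDl -{2}(mul1r `|F x0|) -mulrDl.
apply: lerD.
- rewrite -meshS; apply: le_trans (euler_halving x0 k (ltW m0) h1) _.
  rewrite -[leRHS](_ : (t * m) * (K * `|F x0|) * expR (K * t) = _); last by ring.
  have -> : k%:R * (K * m ^+ 2 * `|F x0|) = (k%:R * m * m) * (K * `|F x0|) by ring.
  apply: ler_pM; rewrite ?expR_ge0 ?mulr_ge0 ?(ltW m0)//.
    rewrite ler_wpM2r ?mulr_ge0// ler_wpM2r ?(ltW m0)// (le_trans _ km)//.
    by rewrite mulrA (mulrC _ 2) -mulrA ler_peMl ?mulr_ge0 ?(ltW m0)// ler1n.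
  rewrite ler_expR (_ : 2 * m * K * k%:R = K * (k%:R * (2 * m))) //; ring.
- rewrite distrC; apply: le_trans (euler_dist x0 (ltW m0) m1 (2 * k) b) _.
  rewrite mulrC; apply: ler_pM; rewrite ?mulr_ge0 ?(ltW m0)//.
    by have := euler_speed_decr x0 (ltW m0) m1 0 (2 * k); rewrite addn0.
  by rewrite ler_piMl ?(ltW m0)// (ler_nat _ _ 1).
Qed.

Lemma euler_path_cauchy m n (t : R) : 0 <= t -> (m <= n)%N ->
  `|euler_path m t - euler_path n t| <=
  ((t * K * expR (K * t) + 1) * `|F x0|) * mesh m.
Proof.
move=> t0; set C := _ * `|F x0|.
have C0 : 0 <= C by rewrite mulr_ge0// addr_ge0// !mulr_ge0// expR_ge0.
suff H j : `|euler_path m t - euler_path (j + m) t| <= C * (mesh m - mesh (j + m)).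
  move=> mn; rewrite -(subnK mn); apply: le_trans (H _) _.
  by rewrite ler_wpM2l// gerBl ltW ?mesh_gt0.
elim: j => [|j IH]; first by rewrite !subrr normr0 mulr0.
apply: le_trans (ler_distD (euler_path (j + m) t) _ _) _.
have -> : mesh m - mesh (j.+1 + m) =
  (mesh m - mesh (j + m)) + (mesh (j + m) - mesh (j + m).+1) by rewrite addSn; ring.
by rewrite mulrDr lerD//; exact: euler_path_refine.
Qed.

Lemma euler_path_cvg (t : R) : 0 <= t -> cvg (euler_path n t @[n --> \oo]).
Proof.
move=> t0; apply: (@cvg_of_rate _ _ _ (fun n => _ * mesh n)); last first.
  by move=> m n; exact: euler_path_cauchy.
by rewrite -[X in _ --> X](mulr0 ((t * K * expR (K * t) + 1) * `|F x0|));
  apply: cvgM; [exact: cvg_cst|exact: cvg_mesh].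
Qed.

(** The last three properties hold for the Euler polygons, [t - s] being the
    number of elapsed steps times the mesh, and they pass to the limit; the
    last one encodes that [x] solves [x' = F x]. *)
Lemma euler_flow : exists x : R -> V,
  [/\ x 0 = x0,
      forall s t : R, 0 <= s -> s <= t -> `|F (x t)| <= `|F (x s)|,
      forall s t : R, 0 <= s -> s <= t -> `|x t - x s| <= (t - s) * `|F (x s)| &
      forall s t : R, 0 <= s -> s <= t ->
        `|x t - x s - (t - s) *: F (x s)| <= K * (t - s) ^+ 2 * `|F (x s)|].
Proof.
pose x t := lim (euler_path n t @[n --> \oo]).
have xlim t : 0 <= t -> euler_path n t @[n --> \oo] --> x t := @euler_path_cvg t.
have Fcont : continuous F.
  move=> u; apply/cvgrPdist_le => e e0; apply/nbhs_ballP.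
  have K1 : 0 < K + 1 by rewrite ltr_wpDl.
  exists (e / (K + 1)); first exact: divr_gt0.
  move=> v; rewrite -ball_normE /= ltr_pdivlMr// => uv.
  apply: le_trans (F_lip _ _) _; apply: le_trans (ltW uv).
  by rewrite mulrC ler_wpM2l// lerDl.
have Flim t : 0 <= t -> F (euler_path n t) @[n --> \oo] --> F (x t).
  by move=> t0; apply: continuous_cvg; [exact: Fcont|exact: xlim].
pose d n s t := (cell n t - cell n s)%:R * mesh n.
have dlim s t : 0 <= s -> s <= t -> d n s t @[n --> \oo] --> t - s.
  move=> s0 st; have t0 := le_trans s0 st.
  apply/cvgrPdist_le => e e0.
  have [N _ Ne] : \forall n \near \oo, mesh n < e by apply: (cvgr_lt 0 cvg_mesh).
  exists N => // n /= /Ne me; rewrite /d natrB ?cell_homo// mulrBl.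
  have /andP[s1 s2] := cell_itv n s0; have /andP[t1 t2] := cell_itv n t0.
  by rewrite ler_norml; apply/andP; split; lra.
have path_eq n s t : 0 <= s -> s <= t ->
    euler_path n t = euler (mesh n) x0 (cell n t - cell n s + cell n s).
  by move=> s0 st; rewrite subnK// cell_homo.
have m0 n : 0 <= mesh n by rewrite ltW ?mesh_gt0.
exists x; split.
- apply: cvg_lim; first exact: norm_hausdorff.
  under eq_cvg do rewrite /euler_path /cell mul0r truncn0.
  exact: cvg_cst.
- move=> s t s0 st; have t0 := le_trans s0 st.
  apply: (ler_cvg_to (cvg_norm (Flim _ t0)) (cvg_norm (Flim _ s0))).
  apply: nearW => n.
  have := euler_speed_decr x0 (m0 n) (mesh_le1 n) (cell n s) (cell n t - cell n s).
  by rewrite -path_eq.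
- move=> s t s0 st; have t0 := le_trans s0 st.
  apply: (ler_cvg_to (cvg_norm (cvgB (xlim _ t0) (xlim _ s0)))
    (cvgM (dlim _ _ s0 st) (cvg_norm (Flim _ s0)))).
  apply: nearW => n.
  have := euler_dist x0 (m0 n) (mesh_le1 n) (cell n s) (cell n t - cell n s).
  by rewrite -path_eq.
- move=> s t s0 st; have t0 := le_trans s0 st; rewrite expr2.
  apply: (ler_cvg_to (cvg_norm (cvgB (cvgB (xlim _ t0) (xlim _ s0))
      (cvgZ (dlim _ _ s0 st) (Flim _ s0))))
    (cvgM (cvgM (cvg_cst K) (cvgM (dlim _ _ s0 st) (dlim _ _ s0 st)))
      (cvg_norm (Flim _ s0)))).
  apply: nearW => n.
  have := euler_taylor x0 (m0 n) (mesh_le1 n) (cell n s) (cell n t - cell n s).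
  by rewrite -path_eq.
Qed.

End Euler.

(** * Differentiation on the half-line *)

Section HalfLineCalculus.
Context {R : realType}.

(** Subdividing [[s, t]] into [n] pieces gives the factor [(1 - (t - s) / n)^n].
    It is at least [e^(- (1 + e) (t - s))] as soon as the pieces are no longer
    than [e / (1 + e)], and [e] is arbitrary. *)
Lemma expR_ge_of_rate (g : R -> R) :
  (forall t, 0 <= t -> 0 <= g t) ->
  (forall s t, 0 <= s -> s <= t -> (1 - (t - s)) * g s <= g t) ->
  forall s t, 0 <= s -> s <= t -> expR (- (t - s)) * g s <= g t.
Proof.
move=> g0 gr s t s0 st; set a := t - s; have a0 : 0 <= a by rewrite subr_ge0.
have step (e : R) : 0 < e -> expR (- ((1 + e) * a)) * g s <= g t.
  move=> e0.
  have e1 : 0 < 1 + e by rewrite addr_gt0.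
  pose n := (Num.truncn (a * (1 + e) / e)).+1; pose d := a / n%:R.
  have n0 : 0 < n%:R :> R by rewrite ltr0n.
  have d0 : 0 <= d by rewrite divr_ge0// ltW.
  have de : d * (1 + e) <= e.
    rewrite /d mulrAC ler_pdivrMr// [leRHS]mulrC -ler_pdivrMr//.
    by rewrite ltW// truncnS_gt.
  have de1 : expR (- ((1 + e) * d)) <= 1 - d.
    rewrite expRN -[leRHS](mulfK (lt0r_neq0 (expR_gt0 ((1 + e) * d)))).
    rewrite ler_pdivlMr ?expR_gt0// mulVf ?gt_eqF ?expR_gt0//.
    have := expR_ge1Dx ((1 + e) * d); have d1 : 0 <= 1 - d by nra.
    by move=> /(ler_wpM2l d1); apply: le_trans; nra.
  have it k : expR (- ((1 + e) * d)) ^+ k * g s <= g (s + k%:R * d).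
    elim: k => [|k IH]; first by rewrite mul1r mul0r addr0.
    have kd : 0 <= k%:R * d by rewrite mulr_ge0.
    have sk : 0 <= s + k%:R * d by rewrite addr_ge0.
    have sd : s + k%:R * d <= s + k.+1%:R * d by rewrite lerD2l ler_wpM2r// ler_nat.
    have dE : s + k.+1%:R * d - (s + k%:R * d) = d by rewrite -natr1; ring.
    apply: le_trans (gr _ _ sk sd); rewrite dE.
    rewrite exprS -mulrA ler_pM// ?expR_ge0//.
    by rewrite mulr_ge0 ?exprn_ge0 ?expR_ge0// g0.
  have := it n; rewrite -expRM_natr.
  have nd : n%:R * d = a by rewrite /d mulrC divfK// gt_eqF.
  have sa : s + a = t by rewrite /a addrC subrK.
  by rewrite nd sa mulNr -mulrA (mulrC d) nd.
have : expR (- ((1 + n.+1%:R^-1) * a)) * g s @[n --> \oo] --> expR (- a) * g s.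
  apply: cvgM; last exact: cvg_cst.
  apply: continuous_cvg; first exact: continuous_expR.
  rewrite -[X in _ --> - X]mul1r; apply: cvgN; apply: cvgM; last exact: cvg_cst.
  by rewrite -[X in _ --> X]addr0; apply: cvgD; [exact: cvg_cst|exact: cvg_harmonic].
by move=> /cvgr_to_le; apply; apply: nearW => n; apply: step.
Qed.

Section Derivative.
Context {V : normedModType R}.
Implicit Types (x : R -> V) (v : V).

Lemma has_derive_ge0P x t v : has_derive_ge0 x t v <->
  forall e, 0 < e -> exists2 d, 0 < d &
    forall s, 0 <= s -> s != t -> `|s - t| < d ->
      `|v - (s - t)^-1 *: (x s - x t)| <= e.
Proof.
split.
  move=> /cvgrPdist_le h e /h.
  rewrite near_withinE near_withinE => /nbhs_ballP[d d0 dP].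
  exists d => // s s0 st sd; apply: dP => //.
  by rewrite -ball_normE /= distrC.
move=> h; apply/cvgrPdist_le => e /h[d d0 dP].
rewrite near_withinE near_withinE; apply/nbhs_ballP; exists d => // s.
by rewrite -ball_normE /= distrC => sd st s0; exact: dP.
Qed.

Lemma has_derive_ge0_taylor x t v (C : R) :
  (forall s, 0 <= s -> `|x s - x t - (s - t) *: v| <= C * (s - t) ^+ 2) ->
  has_derive_ge0 x t v.
Proof.
move=> h; apply/has_derive_ge0P => e e0.
have C0 : 0 < `|C| + 1 by rewrite ltr_wpDl.
exists (e / (`|C| + 1)); first exact: divr_gt0.
move=> s s0 st; rewrite ltr_pdivlMr// => sd.
have st0 : s - t != 0 by rewrite subr_eq0.
have -> : v - (s - t)^-1 *: (x s - x t) = - (s - t)^-1 *: (x s - x t - (s - t) *: v).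
  by rewrite [RHS]scalerBr scalerA mulNr mulVf// scaleN1r opprK [RHS]addrC scaleNr.
have n0 : 0 < `|s - t| by rewrite normr_gt0.
rewrite normrZ normrN normfV mulrC ler_pdivrMr//.
apply: le_trans (h _ s0) _; rewrite -(real_normK (num_real (s - t))).
rewrite expr2 mulrA ler_pM2r// mulrC (le_trans _ (ltW sd))// ler_wpM2l//.
by rewrite (le_trans (ler_norm _))// lerDl.
Qed.

Lemma has_derive_ge0_cvg x t v : has_derive_ge0 x t v ->
  x s @[s --> within [set s | 0 <= s] (nbhs t)] --> x t.
Proof.
move=> /has_derive_ge0P/(_ 1 ltr01)[d d0 dP]; apply/cvgrPdist_le => e e0.
have v0 : 0 < `|v| + 1 by rewrite ltr_wpDl.
rewrite near_withinE; apply/nbhs_ballP.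
exists (Num.min d (e / (`|v| + 1))); first by rewrite /= lt_min d0 divr_gt0.
move=> s; rewrite -ball_normE /= distrC lt_min => /andP[sd].
rewrite ltr_pdivlMr// => se s0.
have [->|st] := eqVneq s t; first by rewrite subrr normr0 ltW.
have n0 : 0 < `|s - t| by rewrite normr_gt0 subr_eq0.
rewrite distrC; apply: le_trans (ltW se); rewrite mulrC -ler_pdivrMr//.
have -> : `|x s - x t| / `|s - t| = `|(s - t)^-1 *: (x s - x t)|.
  by rewrite normrZ normfV mulrC.
by rewrite -lerBlDl (le_trans (lerB_dist _ _))// distrC dP.
Qed.

Lemma has_derive_ge0_is_derive x t v : 0 < t -> has_derive_ge0 x t v ->
  is_derive t 1 x v.
Proof.
move=> t0 /has_derive_ge0P h.
have c : h^-1 *: ((x \o shift t) (h *: 1) - x t) @[h --> 0^'] --> v.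
  apply/cvgrPdist_le => e /h[d d0 dP].
  rewrite near_withinE; apply/nbhs_ballP; exists (Num.min d t).
    by rewrite /= lt_min d0.
  move=> s; rewrite -ball_normE /= sub0r normrN lt_min => /andP[sd st] s0.
  have := dP (s + t); rewrite addrK [s *: 1]mulr1; apply => //.
  - by move: st; rewrite ltr_norml => /andP[? _]; lra.
  - by rewrite -subr_eq0 addrK.
by split; [apply/cvg_ex; exists v|exact: cvg_lim].
Qed.

End Derivative.
End HalfLineCalculus.

(** * Uniqueness for Lipschitz vector fields *)

Section Uniqueness.
Context {R : realType} {H : completeNormedModType R}.
Variable dot : {dot H for (@idfun R)}.
Hypothesis norm_dot : forall u : H, `|u| = Num.sqrt (dot u u).

Lemma has_derive_ge0_dot (w : R -> H) (t : R) (v : H) : has_derive_ge0 w t v ->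
  has_derive_ge0 (fun s => dot (w s) (w s)) t (2 * dot v (w t)).
Proof.
move=> wv; rewrite /has_derive_ge0.
have -> : (fun s => (s - t)^-1 *: (dot (w s) (w s) - dot (w t) (w t))) =
    (fun s => dot ((s - t)^-1 *: (w s - w t)) (w s + w t)).
  apply/funext => s; rewrite dotZl; congr (_ * _).
  by rewrite !dotE (dotC dot (w t) (w s)); ring.
have -> : 2 * dot v (w t) = dot v (w t + w t) by rewrite dotDr mulr_natl mulr2n.
apply: cvg_dot => //; apply: cvgD; last exact: cvg_cst.
apply: cvg_trans (has_derive_ge0_cvg wv); apply: cvg_app => P Pt.
have {}Pt : nbhs t [set s | 0 <= s -> P s] := Pt.
change (nbhs t [set s | s != t -> 0 <= s -> P s]).
by apply: filterS Pt => s Ps _.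
Qed.

(** Gronwall: the squared distance of two solutions, multiplied by
    [e^(- 2 K t)], has a nonpositive derivative and starts from [0]. *)
Lemma lipschitz_ode_unique (F : H -> H) (K : R) (x y : R -> H) :
  (forall u v, `|F u - F v| <= K * `|u - v|) ->
  (forall t, 0 <= t -> has_derive_ge0 x t (F (x t))) ->
  (forall t, 0 <= t -> has_derive_ge0 y t (F (y t))) ->
  x 0 = y 0 -> forall t, 0 <= t -> x t = y t.
Proof.
move=> FK xF yF xy0 T; rewrite le_eqVlt => /predU1P[<-//|T0].
pose w t := x t - y t.
have wF t : 0 <= t -> has_derive_ge0 w t (F (x t) - F (y t)).
  move=> t0; rewrite /has_derive_ge0 /w.
  have -> : (fun s => (s - t)^-1 *: (x s - y s - (x t - y t))) =
      (fun s => (s - t)^-1 *: (x s - x t) - (s - t)^-1 *: (y s - y t)).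
    apply/funext => s; rewrite -scalerBr; congr (_ *: _).
    by rewrite !opprD addrACA.
  by apply: cvgB; [exact: xF|exact: yF].
pose d t := dot (w t) (w t).
have dF t (t0 : 0 <= t) := has_derive_ge0_dot (wF t t0).
pose e t := d t * expR (- (2 * K) * t).
have expD (t : R) : is_derive t 1 (fun s : R => expR (- (2 * K) * s))
    (- (2 * K) * expR (- (2 * K) * t)).
  have := is_derive1_comp (is_derive_expR (- (2 * K) * t))
    (is_deriveZ (- (2 * K)) (is_derive_id t 1)).
  by rewrite /GRing.scale /= mulr1 (mulrC (expR _)).
have eD t : t \in `]0, T[%R -> is_derive t 1 e
  (d t *: (- (2 * K) * expR (- (2 * K) * t)) +
   expR (- (2 * K) * t) *: (2 * dot (F (x t) - F (y t)) (w t))).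
  rewrite in_itv /= => /andP[t0 _].
  apply: is_deriveM; exact: has_derive_ge0_is_derive t0 (dF t (ltW t0)).
have eC : {within `[0, T], continuous e}.
  apply/subspace_continuousP => t /=; rewrite in_itv /= => /andP[t0 _].
  apply: cvgM.
    apply: cvg_trans (has_derive_ge0_cvg (dF t t0)); apply: cvg_app => P Pt.
    have {}Pt : nbhs t [set s | 0 <= s -> P s] := Pt.
    change (nbhs t [set s | s \in `[0, T] -> P s]).
    by apply: filterS Pt => s Ps /=; rewrite in_itv /= => /andP[s0 _]; exact: Ps.
  apply: cvg_within_filter; apply: continuous_cvg; first exact: continuous_expR.
  by apply: cvgM; [exact: cvg_cst|exact: cvg_id].
have [c] := MVT T0 eD eC; rewrite in_itv /= => /andP[c0 cT].
have e0 : e 0 = 0 by rewrite /e /d /w xy0 subrr dot0l mul0r.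
rewrite e0 !subr0 => eT.
have {eT} : e T <= 0.
  rewrite eT -(mul0r T) ler_wpM2r ?(ltW T0)//.
  rewrite [leLHS](_ : _ = expR (- (2 * K) * c) *
      (2 * (dot (F (x c) - F (y c)) (w c) - K * d c))); last first.
    by rewrite /GRing.scale /=; ring.
  rewrite pmulr_rle0 ?expR_gt0// pmulr_rle0// subr_le0.
  apply: le_trans (dot_le_norm norm_dot _ _) _.
  rewrite /d (dot_normsq norm_dot) expr2 mulrA ler_wpM2r//; exact: FK.
rewrite /e pmulr_lle0 ?expR_gt0// /d (dot_normsq norm_dot) => wT.
by apply/eqP; rewrite -subr_eq0 -normr_eq0 -sqrf_eq0 eq_le wT sqr_ge0.
Qed.

End Uniqueness.

(** * Solutions of the Cauchy problems *)

Section Solutions.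
Context {R : realType} {H : completeNormedModType R}.
Variable dot : {dot H for (@idfun R)}.
Hypothesis norm_dot : forall u : H, `|u| = Num.sqrt (dot u u).
Variable A : H -> set H.
Hypothesis maxA : maximal_monotone_op dot A.
Variable theta : R.
Hypothesis theta_gt0 : 0 < theta.

Local Notation J := (resolvent A).
Local Notation L := (Lambda A theta).
Local Notation F := (velocity A theta).

Lemma solution_pair_velocity (x0 : H) (x : R -> H) (lam : R -> R) :
  solution_pair A theta x0 x lam -> forall t, 0 <= t ->
  [/\ nonzeros_op A (x t), lam t = L (x t) & has_derive_ge0 x t (F (x t))].
Proof.
move=> [sol _] t /sol[[dx xdx dxE] lam0]; rewrite distrC => lamE.
have Llam := Lambda_uniq norm_dot maxA theta_gt0 lam0 lamE.
split; [exact: (index_nonzero norm_dot maxA theta_gt0 lamE lam0)|exact/esym|].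
by rewrite /velocity Llam -(subr0_eq dxE) addrK.
Qed.

Lemma solution_autonomous_velocity (x0 : H) (x : R -> H) :
  solution_autonomous A theta x0 x ->
  forall t, 0 <= t -> has_derive_ge0 x t (F (x t)).
Proof.
move=> [sol _] t /sol[_ [dx xdx /subr0_eq]].
by rewrite /velocity => <-; rewrite addrK.
Qed.

Lemma velocity_solution_pair (x0 : H) (x : R -> H) (lam : R -> R) : x 0 = x0 ->
  (forall t, 0 <= t -> lam t = L (x t)) ->
  (forall t, 0 <= t -> nonzeros_op A (x t)) ->
  (forall t, 0 <= t -> has_derive_ge0 x t (F (x t))) ->
  solution_pair A theta x0 x lam.
Proof.
move=> xx0 lamL nx dx; split => // t t0; rewrite lamL//.
have [L0 LE] := Lambda_spec norm_dot maxA theta_gt0 (nx t t0).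
split; [exists (F (x t)); first exact: dx| |by rewrite distrC] => //.
by rewrite /velocity subrK subrr.
Qed.

Lemma velocity_solution_autonomous (x0 : H) (x : R -> H) : x 0 = x0 ->
  (forall t, 0 <= t -> nonzeros_op A (x t)) ->
  (forall t, 0 <= t -> has_derive_ge0 x t (F (x t))) ->
  solution_autonomous A theta x0 x.
Proof.
move=> xx0 nx dx; split => // t t0; split; first exact: nx.
by exists (F (x t)); [exact: dx|rewrite /velocity subrK subrr].
Qed.

(** The solution stays away from the zeros of [A] because its speed is at least
    [e^(- t)] times the initial one. *)
Lemma velocity_flow (x0 : H) : nonzeros_op A x0 -> exists x : R -> H,
  [/\ x 0 = x0,
      forall t, 0 <= t -> nonzeros_op A (x t),
      forall t, 0 <= t -> has_derive_ge0 x t (F (x t)),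
      forall s t, 0 <= s -> s <= t ->
        expR (- (t - s)) * `|F (x s)| <= `|F (x t)| <= `|F (x s)| &
      forall s t, 0 <= s -> 0 <= t -> `|x s - x t| <= `|F x0| * `|s - t|].
Proof.
move=> nx0.
have [x [xx0 decr dist taylor]] := euler_flow (ler0n R 2)
  (velocity_lip norm_dot maxA theta_gt0)
  (norm_velocity_euler norm_dot maxA theta_gt0) x0.
have Fx0 t : 0 <= t -> `|F (x t)| <= `|F x0| by move=> t0; rewrite -xx0 decr.
have lower s t : 0 <= s -> s <= t -> expR (- (t - s)) * `|F (x s)| <= `|F (x t)|.
  apply: (@expR_ge_of_rate _ (fun t => `|F (x t)|)) => // {}s {}t s0 st.
  rewrite mulrBl mul1r lerBlDr.
  apply: le_trans (norm_velocity_lip norm_dot maxA theta_gt0 (x s) (x t)) _.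
  by rewrite lerD2l distrC dist.
have lip s t : 0 <= s -> 0 <= t -> `|x s - x t| <= `|F x0| * `|s - t|.
  wlog st : s t / s <= t => [W s0 t0|s0 t0].
    have [st|/ltW ts] := leP s t; first exact: W.
    by rewrite distrC (distrC s) W.
  rewrite distrC (distrC s) (@ger0_norm _ (t - s)) ?subr_ge0// mulrC.
  by apply: le_trans (dist _ _ s0 st) _; rewrite ler_wpM2l ?subr_ge0 ?Fx0.
exists x; split => //.
- move=> t t0 Axt; have := lower 0 t (lexx 0) t0.
  rewrite (velocity_zero norm_dot maxA theta_gt0 Axt) normr0 xx0.
  apply/negP; rewrite -ltNge.
  by rewrite mulr_gt0 ?expR_gt0// (norm_velocity_gt0 norm_dot maxA).
- move=> t t0; apply: (@has_derive_ge0_taylor _ _ _ _ _ (4 * `|F x0|)) => s s0.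
  have [ts|/ltW st] := leP t s.
    apply: le_trans (taylor _ _ t0 ts) _.
    have := Fx0 t t0; have := normr_ge0 (F x0); have := sqr_ge0 (s - t); nra.
  (* For the left derivative, expand at [s] and move the velocity to [t]. *)
  have -> : x s - x t - (s - t) *: F (x t) =
      - (x t - x s - (t - s) *: F (x s)) + (t - s) *: (F (x t) - F (x s)).
    move: (F (x s)) (F (x t)) => f g.
    by rewrite scalerBr opprB [RHS]addrC addrA subrK opprB [LHS]addrC -scaleNr opprB.
  apply: le_trans (ler_normD _ _) _; rewrite normrN normrZ.
  have a1 := taylor _ _ s0 st.
  have a2 := velocity_lip norm_dot maxA theta_gt0 (x t) (x s).
  have a3 := dist _ _ s0 st; have a4 := Fx0 s s0.
  have ts0 : 0 <= t - s by rewrite subr_ge0.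
  rewrite (ger0_norm ts0).
  have a5 : (t - s) * `|F (x t) - F (x s)| <= 2 * (t - s) ^+ 2 * `|F (x s)|.
    by move: a2 a3 ts0; move: (t - s) => u a2 a3 u0; nra.
  have a6 : (t - s) ^+ 2 * `|F (x s)| <= (t - s) ^+ 2 * `|F x0|.
    by rewrite ler_wpM2l ?sqr_ge0.
  have -> : (s - t) ^+ 2 = (t - s) ^+ 2 by rewrite -sqrrN opprB.
  lra.
- by move=> s t s0 st; rewrite lower//= decr.
Qed.

End Solutions.

(** Local Lipschitz continuity on [[0, +oo[] is tested near each pair of points
    [(a, b)], which may be far apart, so the constant is taken for a whole
    interval [[0, T]] containing both. *)
Lemma locally_lipschitz_of_expR_growth {R : realType} (f : R -> R) :
  (forall t, 0 <= t -> 0 <= f t) ->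
  (forall s t, 0 <= s -> s <= t -> f s <= f t <= expR (t - s) * f s) ->
  [locally [lipschitz f t | t in [set t : R | 0 <= t]]].
Proof.
move=> f0 fE [a b] [/= a0 b0]; rewrite /lipschitz_on.
pose T := a + b + 1; have T0 : 0 <= T by rewrite !addr_ge0.
pose k := expR T * f T.
have lip s t : 0 <= s -> s <= t -> t <= T -> `|f t - f s| <= k * (t - s).
  move=> s0 st tT; have /andP[f1 f2] := fE _ _ s0 st.
  have t0 := le_trans s0 st.
  have /andP[f3 _] := fE _ _ s0 (le_trans st tT).
  have fs0 := f0 s s0.
  rewrite ger0_norm ?subr_ge0//.
  have ts0 : 0 <= t - s by rewrite subr_ge0.
  have eT : expR (t - s) <= expR T by rewrite ler_expR; lra.
  apply: (@le_trans _ _ ((t - s) * expR (t - s) * f s)).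
    have : 1 - (t - s) <= expR (- (t - s)) := expR_ge1Dx _.
    move=> /(ler_wpM2l (expR_ge0 (t - s))); rewrite -expRD subrr expR0.
    by nra.
  by rewrite -mulrA [leRHS]mulrC ler_wpM2l// ler_pM ?expR_ge0.
near=> M.
have kM : k <= M by near: M; apply: nbhs_pinfty_ge; exact: num_real.
have near_lt : \forall p \near (a, b), p.1 < T /\ p.2 < T.
  exists ([set s | s < T], [set s | s < T]); last by move=> p [].
  by split; apply: lt_nbhsl; rewrite /T /=; lra.
rewrite /dominated_by /self_sub /within /=.
apply: filterS near_lt => -[s t] [/= sT tT] [/= s0 t0].
apply: (@le_trans _ _ (k * `|s - t|)); last by rewrite ler_wpM2r.
have [st|/ltW ts] := leP s t.
  by rewrite distrC (distrC s) (@ger0_norm _ (t - s)) ?subr_ge0// lip// ltW.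
by rewrite (@ger0_norm _ (s - t)) ?subr_ge0// lip// ltW.
Unshelve. all: by end_near.
Qed.

(** * The theorem *)

Theorem theorem2p4 (R : realType) (H : completeNormedModType R)
    (dot : {dot H for (@idfun R)})
    (norm_dot : forall u : H, `|u| = Num.sqrt (dot u u))
    (A : H -> set H) (maxA : maximal_monotone_op dot A)
    (theta : R) (theta_gt0 : 0 < theta)
    (x0 : H) (x0_nonzero : nonzeros_op A x0) :
  [/\ (* existence and uniqueness for the problem in (x, lambda) *)
      exists (x : R -> H) (lam : R -> R),
        solution_pair A theta x0 x lam /\
        forall (y : R -> H) (mu : R -> R), solution_pair A theta x0 y mu ->
          forall t : R, 0 <= t -> y t = x t /\ mu t = lam t,
      (* existence and uniqueness for the autonomous problem *)
      exists x : R -> H,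
        solution_autonomous A theta x0 x /\
        forall y : R -> H, solution_autonomous A theta x0 y ->
          forall t : R, 0 <= t -> y t = x t,
      (* equivalence of the two problems *)
      forall (x : R -> H) (lam : R -> R),
        solution_pair A theta x0 x lam <->
        solution_autonomous A theta x0 x /\
        forall t : R, 0 <= t -> lam t = Lambda A theta (x t) &
      (* properties of the solution *)
      forall (x : R -> H) (lam : R -> R), solution_pair A theta x0 x lam ->
        let res t := `|resolvent A (lam t) (x t) - x t| in
        [/\ C1_ge0 x,
            [locally [lipschitz lam t | t in [set t : R | 0 <= t]]],
            forall s t : R, 0 <= s -> s <= t -> lam s <= lam t,
            forall s t : R, 0 <= s -> s <= t -> res t <= res s &
            forall t0 t1 : R, 0 <= t0 -> t0 <= t1 ->
              lam t0 <= lam t1 <= expR (t1 - t0) * lam t0 /\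
              res t0 * expR (- (t1 - t0)) <= res t1 <= res t0]].

Proof.
have [X [X0 nX dX XF Xlip]] := velocity_flow norm_dot maxA theta_gt0 x0_nonzero.
have FK := velocity_lip norm_dot maxA theta_gt0.
have uniq y : y 0 = x0 ->
    (forall t, 0 <= t -> has_derive_ge0 y t (velocity A theta (y t))) ->
    forall t, 0 <= t -> y t = X t.
  by move=> y0 dy; apply: (lipschitz_ode_unique norm_dot FK dy dX); rewrite y0.
have pairX x lam : solution_pair A theta x0 x lam -> forall t, 0 <= t ->
    [/\ x t = X t, lam t = Lambda A theta (X t) &
        `|resolvent A (lam t) (x t) - x t| = `|velocity A theta (X t)|].
  move=> sol; have sF := solution_pair_velocity norm_dot maxA theta_gt0 sol.
  have xX : forall t, 0 <= t -> x t = X t.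
    by apply: uniq => [|t /sF[]//]; case: sol.
  move=> t t0; have [_ lamE _] := sF t t0.
  by rewrite lamE xX.
split.
- exists X, (fun t => Lambda A theta (X t)); split.
    exact: (velocity_solution_pair norm_dot maxA theta_gt0).
  by move=> y mu /pairX sol t /sol[].
- exists X; split; first exact: velocity_solution_autonomous.
  move=> y sol; apply: uniq; first by case: sol.
  exact: solution_autonomous_velocity sol.
- move=> x lam; split=> [sol|[sol lamE]].
    have sF := solution_pair_velocity norm_dot maxA theta_gt0 sol.
    split; last by move=> t /sF[].
    by apply: velocity_solution_autonomous => [|t /sF[]|t /sF[]]//; case: sol.
  apply: (velocity_solution_pair norm_dot maxA theta_gt0) => //; first by case: sol.
    by move=> t t0; case: (sol.1 t t0).
  exact: solution_autonomous_velocity sol.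
move=> x lam sol res; have sX := pairX x lam sol.
have resE t : 0 <= t -> res t = `|velocity A theta (X t)| by move=> /sX[].
have lamE t : 0 <= t -> lam t = theta / res t.
  move=> t0; have [_ -> _] := sX t t0.
  by rewrite resE// (norm_velocity norm_dot maxA)// invf_div mulrC divfK ?gt_eqF.
have res0 t : 0 <= t -> 0 < res t.
  by move=> t0; rewrite resE// (norm_velocity_gt0 norm_dot maxA)//; exact: nX.
have resF s t : 0 <= s -> s <= t -> expR (- (t - s)) * res s <= res t <= res s.
  by move=> s0 st; rewrite !resE ?(le_trans s0)//; exact: XF.
have lamF s t : 0 <= s -> s <= t -> lam s <= lam t <= expR (t - s) * lam s.
  move=> s0 st; have t0 := le_trans s0 st.
  have /andP[r1 r2] := resF s t s0 st.
  rewrite !lamE// mulrCA ler_pM2l// lef_pV2 ?posrE ?res0// r2 /=.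
  rewrite ler_pM2l// -[expR (t - s)]invrK -expRN -invfM lef_pV2 ?posrE ?res0//.
  by rewrite mulr_gt0 ?expR_gt0 ?res0.
split.
- exists (fun t => velocity A theta (x t)).
    by move=> t t0; case: (solution_pair_velocity norm_dot maxA theta_gt0 sol t0).
  apply: (@lipschitz_within_continuous _ _ _ _ (2 * `|velocity A theta x0|)).
  move=> s t s0 t0.
  have [-> _ _] := sX s s0; have [-> _ _] := sX t t0.
  by apply: le_trans (FK _ _) _; rewrite -mulrA ler_wpM2l// Xlip.
- apply: locally_lipschitz_of_expR_growth => // t t0.
  by rewrite lamE// divr_ge0 ?(ltW theta_gt0) ?(ltW (res0 _ _)).
- by move=> s t s0 st; case/andP: (lamF s t s0 st).
- by move=> s t s0 st; case/andP: (resF s t s0 st).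
- by move=> s t s0 st; rewrite lamF// mulrC resF.
Qed.
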